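(* For each $n$ let $X=X(n)$ be an exchangeable random covering variable for $V=[n]$, with maximum coupon size $M=M(n)$, average coupon size $\mu=\mu(n)=\mathbb{E}|X|>0$ and mean square coupon size $\chi=\chi(n)=\mathbb{E}[|X|^2]$. If any of the four conditions below holds, then whp $T(\mathbf{X})=(1+o(1))\frac{\log n}{-\log(1-\frac\mu n)}$ (which in the case $\mu=o(n)$ can be rewritten as $T(\mathbf{X})=(1+o(1))\frac{n\log n}{\mu}$): (i) $M=o(\sqrt{n\log n})$; (ii) $M=o(n)$ and $M=o(\sqrt{\mu n\log n})$; (iii) $M=o(n)$ and $\chi=o(\mu n\log n)$; (iv) $\mu<(1-\delta)n$ for some fixed $\delta>0$, and $\chi=\left(1+o\left(\frac{1}{\mu n\log n}\right)\right)\mu^2$.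
   Context: A random covering variable (random coupon) for a finite set $V$ is a random variable $X$ with values in the power set of $V$. It is exchangeable if its law is invariant under every permutation of $V$. The maximum coupon size $M$ is the largest value that $|X|$ takes with strictly positive probability. The $X$-coupon collector receives i.i.d. coupons $\mathbf{X}=(X_1,X_2,\dots)$ with $X_i\sim X$; $C_t=\bigcup_{i\le t}X_i$; the covering time is $T(\mathbf{X})=\inf\{t\in\mathbb{Z}_{\ge0}:C_t=V\}$. ''$T=(1+o(1))f(n)$ whp'' means $T/f(n)\to1$ in probability as $n\to\infty$. *)

(* Defs.v *)
Set Warnings "-redundant-canonical-projection".
From HB Require Import structures.
From mathcomp Require Export all_boot all_order all_algebra all_fingroup finmap.
From mathcomp Require Export all_classical all_reals all_analysis.
Export Order.TTheory GRing.Theory Num.Theory numFieldNormedType.Exports.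

Set Implicit Arguments.
Unset Strict Implicit.
Unset Printing Implicit Defensive.

Local Open Scope classical_set_scope.
Local Open Scope ring_scope.

(* The power set {set V} of a finite set carries its discrete sigma-algebra,
   so that {RV P >-> {set V}} is the type of random subsets of V. *)
HB.instance Definition _ (V : finType) := isPointed.Build {set V} finset.set0.
HB.instance Definition _ (V : finType) :=
  @isMeasurable.Build default_measure_display {set V}
    discrete_measurable discrete_measurable0
    discrete_measurableC discrete_measurableU.

Section random_coupon.
Context (R : realType) (d : measure_display) (Om : measurableType d)
  (P : probability Om R) (V : finType).

Definition exchangeable (X : {RV P >-> {set V}}) : Prop :=
  forall (s : {perm V}) (B : set {set V}),
    P [set w | B (s @: X w)%SET] = P (X @^-1` B).

Definition max_size (X : {RV P >-> {set V}}) : nat :=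
  \max_(k < #|V|.+1 | (0 < P [set w | #|X w| = k])%E) k.

Definition mean_size (X : {RV P >-> {set V}}) : R :=
  fine ('E_P[fun w => (#|X w|%:R : R)%R])%E.

Definition mean_square_size (X : {RV P >-> {set V}}) : R :=
  fine ('E_P[fun w => (#|X w|%:R ^+ 2 : R)%R])%E.

Definition mutually_independent (Xs : nat -> {RV P >-> {set V}}) : Prop :=
  forall (J : {fset nat}) (B : nat -> set {set V}),
    P (\bigcap_(i in [set` J]) (Xs i @^-1` B i)) =
    (\prod_(i <- J) P (Xs i @^-1` B i))%E.

(* The coupons are numbered from 0: Xs 0, ..., Xs t.-1 are the first t. *)
Definition collected (Xs : nat -> {RV P >-> {set V}}) (t : nat) (w : Om) :
  {set V} := (\bigcup_(i < t) Xs i w)%SET.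

(* +oo when V is never covered. *)
Definition covering_time (Xs : nat -> {RV P >-> {set V}}) (w : Om) : \bar R :=
  ereal_inf [set t%:R%:E | t in [set t : nat | collected Xs t w = [set: V]%SET]].

End random_coupon.

(* Xs is an i.i.d. sequence with the law of X; the coupon X and the sequence Xs
   may live on different probability spaces. *)
Definition iid_coupons (R : realType) (d d' : measure_display)
    (Om : measurableType d) (Om' : measurableType d')
    (P : probability Om R) (P' : probability Om' R) (V : finType)
    (X : {RV P >-> {set V}}) (Xs : nat -> {RV P' >-> {set V}}) : Prop :=
  (forall i (B : set {set V}),
    distribution P' (Xs i) B = distribution P X B) /\
  mutually_independent Xs.

(* T n = (1 + o(1)) f n whp, i.e. T n / f n tends to 1 in probability; each T n
   is defined on its own probability space. *)
Definition whp_asymptotic (R : realType) (d : nat -> measure_display)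
    (Om : forall n, measurableType (d n)) (P : forall n, probability (Om n) R)
    (T : forall n, Om n -> \bar R) (f : nat -> R) : Prop :=
  forall eps : R, 0 < eps ->
    (fun n => P n [set w | (eps%:E < `|T n w * (f n)^-1%:E - 1|)%E])
      @ \oo --> 0%E.

(* Main.v *)
(* Let p = mu/n and L = -log(1 - p).  A given element is missed by t coupons with
   probability (1 - p)^t, so the expected number of missed elements tends to 0 at
   t = (1 + delta) log n / L.  For the lower bound take t = (1 - delta) log n / L
   and apply Chebyshev's inequality to
     Z = sum_v prod_{i <= t} g(|X_i|) [v not in X_i],
   which vanishes when everything is covered.  In cases (i)-(iii) M = o(n), and
   this alone suffices: with g(k) = n / (n - k) the products have mean 1, those of
   distinct elements are negatively correlated, and the second moment of each one
   is at most (1 + p / (1 - M/n))^t <= n^(1 - delta/2).  In case (iv) take g = 1;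
   then the correlation between distinct elements contributes at most
   (1 + (chi/n^2 - p^2) / (1 - p)^2)^t - 1 = o(1). *)
Require Import Defs.
From mathcomp Require Import measurable_realfun ring lra.
Set Implicit Arguments.
Unset Strict Implicit.
Unset Printing Implicit Defensive.

Local Open Scope classical_set_scope.
Local Open Scope ring_scope.

(** * Avoidance moments for exchangeable weights on subsets *)

Section exchangeable_weights.
Context (R : realFieldType) (V : finType) (m : {set V} -> R).
Hypothesis m_ge0 : forall B, 0 <= m B.
Hypothesis m_exch : forall (s : {perm V}) (B : {set V}), m (s @: B)%SET = m B.
Implicit Types (B : {set V}) (g : nat -> R) (u v : V).
Local Notation n := (#|V|).

(** The probability that a uniformly random set of size [#|B|] misses a given element. *)
Definition missed (B : {set V}) : R := 1 - #|B|%:R / n%:R.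

Lemma sum_indicator (A : {pred V}) : \sum_v (v \in A)%:R = #|A|%:R :> R.
Proof. by rewrite -natr_sum -big_mkcond sum1_card. Qed.

Lemma sum_tperm u v (F : {set V} -> R) :
  \sum_B m B * F (tperm u v @: B)%SET = \sum_B m B * F B.
Proof.
have K : involutive (fun B : {set V} => (tperm u v @: B)%SET).
  by move=> B /=; rewrite -imset_comp (eq_imset (g := id)) ?imset_id// => x /=; rewrite tpermK.
rewrite [RHS](reindex_inj (can_inj K)).
by apply: eq_bigr => B _; rewrite m_exch.
Qed.

Lemma mem_tperm_imset u v w B : (w \in (tperm u v @: B)%SET) = (tperm u v w \in B).
Proof. by rewrite -{1}(tpermK u v w) mem_imset//; exact: perm_inj. Qed.

(** By exchangeability the left side does not depend on [v]; averaging it over all [v] replaces the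
    indicator by the proportion of elements outside [B]. *)
Lemma sum_avoid g v : (0 < n)%N ->
  \sum_B m B * (g #|B| * (v \notin B)%:R) = \sum_B m B * (g #|B| * missed B).
Proof.
move=> n_gt0.
have n_neq0 : n%:R != 0 :> R by rewrite pnatr_eq0 -lt0n.
apply: (mulfI n_neq0).
pose F u := \sum_B m B * (g #|B| * (u \notin B)%:R).
have Fc u : F u = F v.
  rewrite /F -(sum_tperm v u); apply: eq_bigr => B _.
  by rewrite card_imset ?mem_tperm_imset ?tpermR//; exact: perm_inj.
rewrite -/(F v); transitivity (\sum_u F u).
  by rewrite (eq_bigr _ (fun u _ => Fc u)) sumr_const mulr_natl.
rewrite exchange_big mulr_sumr /=; apply: eq_bigr => B _.
rewrite -2!mulr_sumr [RHS]mulrCA [in RHS](mulrCA n%:R); congr (_ * (_ * _)).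
rewrite (eq_bigr (fun u => 1 - (u \in B)%:R)) => [|u _]; last first.
  by case: (u \in B) => /=; rewrite ?subrr ?subr0.
rewrite sumrB sum_indicator sumr_const -mulr_natl mulr1 /missed; field; exact: n_neq0.
Qed.

(** Negative correlation, as in sampling without replacement: averaging over [v != u] and then over
    [u] gives the factor [(1 - k/n) (n - k - 1) / (n - 1)] for sets of size [k], which is at most
    [(1 - k/n)^2]. *)
Lemma sum_avoid2 g u v : (forall k, 0 <= g k) -> u != v ->
  \sum_B m B * (g #|B| * ((u \notin B)%:R * (v \notin B)%:R)) <=
  \sum_B m B * (g #|B| * missed B ^+ 2).
Proof.
move=> g_ge0 uv.
have n_gt1 : (1 < n)%N by rewrite (cardD1 u) inE (cardD1 v) !inE eq_sym uv.
have n1_gt0 : 0 < n%:R - 1 :> R by rewrite subr_gt0 ltr1n.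
have n_gt0 : 0 < n%:R :> R by rewrite ltr0n ltnW.
pose F w := \sum_B m B * (g #|B| * ((u \notin B)%:R * (w \notin B)%:R)).
have Fc w : w != u -> F w = F v.
  move=> wu; rewrite /F -(sum_tperm v w); apply: eq_bigr => B _.
  rewrite card_imset; last exact: perm_inj.
  by rewrite !mem_tperm_imset tpermR tpermD // eq_sym.
have Fsum : (n%:R - 1) * F v = \sum_(w | w != u) F w.
  rewrite (eq_bigr _ Fc) sumr_const -[RHS]mulr_natl.
  congr (_ * _); rewrite -(natrB _ (ltnW n_gt1)) subn1; congr (_%:R).
  exact/esym/cardC1.
rewrite -/(F v) -(ler_pM2l n1_gt0) Fsum exchange_big /=.
have -> : \sum_B \sum_(w | w != u) m B * (g #|B| * ((u \notin B)%:R * (w \notin B)%:R)) =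
    \sum_B m B * ((g #|B| * (n%:R - #|B|%:R - 1)) * (u \notin B)%:R).
  apply: eq_bigr => B _; rewrite -3!mulr_sumr mulrA -mulrA.
  case: (boolP (u \in B)) => uB; rewrite ?(mul0r, mulr0, mul1r, mulr1)//.
  congr (_ * (_ * _)).
  (* When [u] is outside [B], so are [n - #|B| - 1] of the other elements. *)
  transitivity (\sum_w (1 - (w \in B)%:R) - 1 : R); last first.
    by rewrite sumrB sum_indicator sumr_const.
  rewrite [in RHS](bigD1 u)//= (negbTE uB) subr0 addrAC subrr add0r.
  by apply: eq_bigr => w _; case: (w \in B) => /=; rewrite ?subrr ?subr0.
(* This count depends only on the size of [B], so it joins the weight; [sum_avoid] allows the
   negative value at [k = n]. *)
rewrite (@sum_avoid (fun k => g k * (n%:R - k%:R - 1)) u) ?(ltnW n_gt1)//.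
rewrite mulr_sumr; apply: ler_sum => B _.
rewrite [leRHS]mulrCA ler_wpM2l// [leRHS]mulrCA -mulrA ler_wpM2l//.
have kn : #|B|%:R <= n%:R :> R by rewrite ler_nat max_card.
have a_ge0 : 0 <= missed B by rewrite subr_ge0 ler_pdivrMr ?mul1r.
rewrite expr2 mulrA ler_wpM2r// /missed -subr_ge0.
have -> : (n%:R - 1) * (1 - #|B|%:R / n%:R) - (n%:R - #|B|%:R - 1) = #|B|%:R / n%:R :> R.
  by field; exact: lt0r_neq0.
by rewrite divr_ge0.
Qed.

(** * Covering by [t] independent coupons *)

Context (t : nat).
Hypothesis m_sum1 : \sum_B m B = 1.
Implicit Types (f : {ffun 'I_t -> {set V}}) (F G : {set V} -> R).

Let weight f := \prod_i m (f i).
Let covers f := (\bigcup_i f i)%SET == [set: V]%SET.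

(** [weight] is the product law of [t] independent coupons, so expectations of products
    factorize. *)
Lemma sum_ffun_prod F :
  \sum_f weight f * \prod_i F (f i) = (\sum_B m B * F B) ^+ t.
Proof.
transitivity (\prod_(i < t) \sum_B m B * F B); last by rewrite prodr_const card_ord.
by rewrite bigA_distr_bigA; apply: eq_bigr => f _; rewrite -big_split.
Qed.

Lemma weight_ge0 f : 0 <= weight f.
Proof. exact: prodr_ge0. Qed.

Lemma sum_weight : \sum_f weight f = 1.
Proof.
rewrite -(expr1n R t) -m_sum1 -[in RHS](eq_bigr _ (fun B _ => mulr1 (m B))) -sum_ffun_prod.
by apply: eq_bigr => f _; rewrite big1 ?mulr1.
Qed.

(** Union bound over the element left out; a fixed element is missed by all [t] coupons with the
    [t]-th power of the one-coupon probability. *)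
Lemma sum_not_covers : (0 < n)%N ->
  \sum_(f | ~~ covers f) weight f <= n%:R * (\sum_B m B * missed B) ^+ t.
Proof.
move=> n_gt0.
apply: (@le_trans _ _ (\sum_f \sum_v weight f * \prod_i (v \notin f i)%:R)).
  rewrite big_mkcond; apply: ler_sum => f _; rewrite -mulr_sumr.
  have S_ge0 v : 0 <= \prod_i (v \notin f i)%:R :> R by exact: prodr_ge0.
  case: ifPn => [|_]; last by rewrite mulr_ge0 ?weight_ge0 ?sumr_ge0.
  rewrite /covers finset.eqEsubset finset.subsetT /= => /subsetPn[v _ vf].
  rewrite ler_peMr ?weight_ge0// (bigD1 v)//= big1 ?lerDl ?sumr_ge0// => i _.
  by rewrite (contra _ vf)// => vi; apply/bigcupP; exists i.
rewrite exchange_big /= (eq_bigr (fun=> (\sum_B m B * missed B) ^+ t)).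
  by rewrite sumr_const mulr_natl.
move=> v _; rewrite (sum_ffun_prod (fun B => (v \notin B)%:R)); congr (_ ^+ t).
have /= := sum_avoid (fun=> 1) v n_gt0.
by under eq_bigr do rewrite mul1r; under [in RHS]eq_bigr do rewrite mul1r.
Qed.

(* Chebyshev's inequality for [Z = \sum_v \prod_i g #|f i| * (v \notin f i)],
   which vanishes when the coupons cover [V]. *)
Lemma sum_covers g : (forall k, 0 <= g k) -> (0 < n)%N ->
  let c := \sum_B m B * (g #|B| * missed B) in
  let d := \sum_B m B * (g #|B| ^+ 2 * missed B) in
  let e := \sum_B m B * (g #|B| ^+ 2 * missed B ^+ 2) in
  (\sum_(f | covers f) weight f) * (n%:R * c ^+ t) ^+ 2 <=
  n%:R * d ^+ t + n%:R ^+ 2 * e ^+ t - (n%:R * c ^+ t) ^+ 2.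
Proof.
move=> g_ge0 n_gt0; set c := \sum_B _; set d := \sum_B _; set e := \sum_B _; cbv zeta.
pose h v B : R := g #|B| * (v \notin B)%:R.
pose Z f := \sum_v \prod_i h v (f i).
set z := n%:R * c ^+ t.
have EZ : \sum_f weight f * Z f = z.
  under eq_bigr do rewrite mulr_sumr.
  rewrite /z mulr_natl exchange_big /= (eq_bigr (fun=> c ^+ t)) ?sumr_const// => v _.
  by rewrite sum_ffun_prod sum_avoid.
have e_ge0 : 0 <= e.
  by apply: sumr_ge0 => B _; rewrite mulr_ge0// mulr_ge0 ?sqr_ge0.
have EZ2 : \sum_f weight f * Z f ^+ 2 <= n%:R * d ^+ t + n%:R ^+ 2 * e ^+ t.
  have -> : \sum_f weight f * Z f ^+ 2 =
      \sum_u \sum_v (\sum_B m B * (h u B * h v B)) ^+ t.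
    under eq_bigr do rewrite expr2 /Z mulr_suml mulr_sumr.
    rewrite exchange_big /=; apply: eq_bigr => u _.
    under eq_bigr do rewrite mulr_sumr mulr_sumr.
    rewrite exchange_big /=; apply: eq_bigr => v _.
    rewrite -sum_ffun_prod; apply: eq_bigr => f _.
    by rewrite -big_split.
  have E (k : R) : n%:R * k = \sum_(u : V) k by rewrite sumr_const mulr_natl.
  (* The diagonal pairs give [d ^+ t] each and the other pairs at most [e ^+ t]; granting [e ^+ t]
     to all pairs only enlarges the bound. *)
  rewrite expr2 -mulrA !E -big_split /=; apply: ler_sum => u _.
  rewrite (bigD1 u)//= [in leRHS](bigD1 u)//=.
  have -> : \sum_B m B * (h u B * h u B) = d.
    have /= := sum_avoid (fun k => g k ^+ 2) u n_gt0; rewrite -/d => <-; apply: eq_bigr => B _.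
    by rewrite /h; case: (u \notin B); rewrite ?(mulr0, mul0r)// !mulr1 expr2.
  rewrite lerD2l -[leLHS]add0r lerD ?exprn_ge0//; apply: ler_sum => v vu.
  have -> : \sum_B m B * (h u B * h v B) =
      \sum_B m B * (g #|B| ^+ 2 * ((u \notin B)%:R * (v \notin B)%:R)).
    by apply: eq_bigr => B _; rewrite /h; congr (_ * _); ring.
  apply: lerXn2r; rewrite ?nnegrE//.
    by apply: sumr_ge0 => B _; rewrite mulr_ge0// mulr_ge0 ?sqr_ge0// mulr_ge0.
  by apply: (@sum_avoid2 (fun k => g k ^+ 2)); rewrite 1?eq_sym// => k; exact: sqr_ge0.
have Zcov f : covers f -> Z f = 0.
  move=> /eqP cf; apply: big1 => v _.
  have /bigcupP[i _ vi] : v \in (\bigcup_i f i)%SET by rewrite cf inE.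
  by rewrite (bigD1 i)//= /h vi mulr0 mul0r.
have EV : \sum_f weight f * (Z f - z) ^+ 2 = \sum_f weight f * Z f ^+ 2 - z ^+ 2.
  transitivity (\sum_f (weight f * Z f ^+ 2 - (2 * z) * (weight f * Z f) + z ^+ 2 * weight f)).
    by apply: eq_bigr => f _; ring.
  by rewrite !big_split /= sumrN -!mulr_sumr EZ sum_weight; ring.
(* Each covering [f] contributes [z ^+ 2] to the variance of [Z], since [Z f = 0]. *)
apply: (@le_trans _ _ (\sum_f weight f * (Z f - z) ^+ 2)); last first.
  by rewrite EV lerD2r.
rewrite mulr_suml big_mkcond; apply: ler_sum => f _.
case: ifPn => [cf|_]; last by rewrite mulr_ge0 ?weight_ge0 ?sqr_ge0.
by rewrite Zcov// sub0r sqrrN.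
Qed.

Lemma sum_missed :
  \sum_B m B * missed B = 1 - (\sum_B m B * #|B|%:R) / n%:R.
Proof.
rewrite -[X in _ = X - _]m_sum1 mulr_suml -sumrB; apply: eq_bigr => B _.
by rewrite /missed mulrBr mulr1 mulrA.
Qed.

Lemma sum_missed_sqr :
  \sum_B m B * missed B ^+ 2 =
  1 - 2 * ((\sum_B m B * #|B|%:R) / n%:R) + (\sum_B m B * #|B|%:R ^+ 2) / n%:R ^+ 2.
Proof.
rewrite -[X in _ = X - _ + _]m_sum1 !mulr_suml mulr_sumr -sumrB -big_split /=.
by apply: eq_bigr => B _; rewrite /missed -exprVn; move: (n%:R^-1) => i; ring.
Qed.

Lemma missed_ge0 B : 0 <= missed B.
Proof.
have [n0|n_gt0] := posnP n; first by rewrite /missed n0 invr0 mulr0 subr0.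
by rewrite subr_ge0 ler_pdivrMr ?ltr0n// mul1r ler_nat max_card.
Qed.

(* [g k] is the inverse of the probability that a coupon of size [k] misses a
   given element, which makes [c = e = 1]. *)
Lemma sum_covers_bounded_size (M : nat) : (M < n)%N ->
  (forall B, 0 < m B -> (#|B| <= M)%N) ->
  \sum_(f | covers f) weight f <=
  (1 + (\sum_B m B * #|B|%:R) / n%:R / (1 - M%:R / n%:R)) ^+ t / n%:R.
Proof.
move=> Mn sizeM; have n_gt0 : (0 < n)%N by exact: leq_ltn_trans Mn.
have nR_gt0 : 0 < n%:R :> R by rewrite ltr0n.
have a_gt0 : 0 < 1 - M%:R / n%:R :> R.
  by rewrite subr_gt0 ltr_pdivrMr// mul1r ltr_nat.
have missed_geM B : 0 < m B -> 1 - M%:R / n%:R <= missed B.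
  by move=> /sizeM BM; rewrite lerD2l lerN2 ler_pM2r ?invr_gt0// ler_nat.
(* The absolute value keeps [g] nonnegative at sizes above [n] too, as [sum_covers] requires. *)
pose g k : R := `|1 - k%:R / n%:R|^-1.
have gE B : g #|B| = (missed B)^-1 by rewrite /g ger0_norm// missed_ge0.
have g_ge0 k : 0 <= g k by rewrite invr_ge0.
(* Identities are needed only on the support of [m], where [missed] is bounded away from [0]. *)
have eq_m F G : (forall B, 0 < m B -> F B = G B) ->
    \sum_B m B * F B = \sum_B m B * G B.
  move=> FG; apply: eq_bigr => B _; have := m_ge0 B.
  by rewrite le_eqVlt => /predU1P[<-|/FG->//]; rewrite !mul0r.
have missed_neq0 B : 0 < m B -> missed B != 0.
  by move=> mB; rewrite gt_eqF// (lt_le_trans a_gt0)// missed_geM.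
have := sum_covers g_ge0 n_gt0; cbv zeta.
have -> : \sum_B m B * (g #|B| * missed B) = 1.
  rewrite -[RHS]m_sum1 -[in RHS](eq_bigr _ (fun B _ => mulr1 (m B))); apply: eq_m => B mB.
  by rewrite gE mulVf ?missed_neq0.
have -> : \sum_B m B * (g #|B| ^+ 2 * missed B ^+ 2) = 1.
  rewrite -[RHS]m_sum1 -[in RHS](eq_bigr _ (fun B _ => mulr1 (m B))); apply: eq_m => B mB.
  by rewrite gE -exprMn mulVf ?missed_neq0 ?expr1n.
(* With [c = e = 1] the two terms in [n^2] cancel and only the diagonal one is left. *)
rewrite expr1n !mulr1 addrK => H.
rewrite ler_pdivlMr// -(ler_pM2l nR_gt0).
apply: le_trans (_ : n%:R * (\sum_B m B * (g #|B| ^+ 2 * missed B)) ^+ t <= _).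
  by apply: le_trans H; rewrite le_eqVlt; apply/orP; left; apply/eqP; ring.
rewrite ler_wpM2l// lerXn2r ?nnegrE//.
- by apply: sumr_ge0 => B _; rewrite mulr_ge0// mulr_ge0 ?sqr_ge0 ?missed_ge0.
- rewrite addr_ge0// divr_ge0 ?(ltW a_gt0)// divr_ge0// sumr_ge0// => B _.
  by rewrite mulr_ge0.
rewrite -[X in X + _]m_sum1 !mulr_suml -big_split /=; apply: ler_sum => B _.
have := m_ge0 B; rewrite le_eqVlt => /predU1P[<-|mB]; first by rewrite !mul0r addr0.
have -> : m B + m B * #|B|%:R / n%:R / (1 - M%:R / n%:R) =
    m B * (1 + #|B|%:R / n%:R / (1 - M%:R / n%:R)) by rewrite mulrDr mulr1 !mulrA.
rewrite ler_pM2l// gE expr2 -mulrA mulVf ?missed_neq0// mulr1.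
(* This form is linear in [#|B|] once [missed B] is bounded below by [1 - M/n], so summing produces
   the mean size. *)
have -> : (missed B)^-1 = 1 + #|B|%:R / n%:R / missed B.
  apply: (mulIf (missed_neq0 _ mB)).
  by rewrite mulVf ?missed_neq0// mulrDl divfK ?missed_neq0// mul1r subrK.
rewrite lerD2l ler_wpM2l ?divr_ge0// lef_pV2 ?posrE ?missed_geM//.
by rewrite (lt_le_trans a_gt0)// missed_geM.
Qed.

(** The choice [g = 1] gives [c = d = 1 - p], and [e] exceeds [c^2] by the variance [q - p^2] of the
    relative size. Dividing Chebyshev's bound by [(n c^t)^2] yields the result. *)
Lemma sum_covers_variance : (0 < n)%N ->
  let p := (\sum_B m B * #|B|%:R) / n%:R in
  let q := (\sum_B m B * #|B|%:R ^+ 2) / n%:R ^+ 2 in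
  p < 1 ->
  \sum_(f | covers f) weight f <=
  (n%:R * (1 - p) ^+ t)^-1 + (1 + (q - p ^+ 2) / (1 - p) ^+ 2) ^+ t - 1.
Proof.
move=> n_gt0 p q p1.
have nR_gt0 : 0 < n%:R :> R by rewrite ltr0n.
have c_gt0 : 0 < 1 - p by rewrite subr_gt0.
have := @sum_covers (fun=> 1) (fun=> ler01) n_gt0; cbv zeta.
have -> : \sum_B m B * (1 * missed B) = 1 - p.
  by under eq_bigr do rewrite mul1r; exact: sum_missed.
have -> : \sum_B m B * (1 ^+ 2 * missed B) = 1 - p.
  by under eq_bigr do rewrite expr1n mul1r; exact: sum_missed.
have -> : \sum_B m B * (1 ^+ 2 * missed B ^+ 2) = (1 - p) ^+ 2 * (1 + (q - p ^+ 2) / (1 - p) ^+ 2).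
  under eq_bigr do rewrite expr1n mul1r.
  by rewrite sum_missed_sqr -/p -/q; field; exact: lt0r_neq0.
rewrite [X in _ + _ * X]exprMn -exprM mulnC exprM.
set c := (1 - p) ^+ t; set x := (_ ^+ t) => H.
have {}c_gt0 : 0 < c by exact: exprn_gt0.
have z_gt0 : 0 < (n%:R * c) ^+ 2 by rewrite exprn_gt0// mulr_gt0.
rewrite -(ler_pM2r z_gt0); apply: le_trans H _; rewrite le_eqVlt; apply/orP; left.
by apply/eqP; field; rewrite !lt0r_neq0.
Qed.

End exchangeable_weights.

(** * From random coupons to finite weights *)

Lemma probability_finite_partition (R : realType) d (Om : measurableType d)
    (P : probability Om R) (F : finType) (Y : Om -> F) (A : pred F) :
  (forall y, measurable (Y @^-1` [set y])) ->
  P [set w | A (Y w)] = (\sum_(y | A y) P (Y @^-1` [set y]))%E.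
Proof.
move=> mY.
have -> : [set w | A (Y w)] = \bigcup_(y in [set` enum A]) (Y @^-1` [set y]).
  apply/seteqP; split => w /=; first by exists (Y w); rewrite //= mem_enum.
  by case=> y /=; rewrite mem_enum => Ay ->.
rewrite measure_fin_bigcup//; last by move=> y z _ _ [w [/= -> ->]].
by rewrite -fsbig_seq ?enum_uniq// big_enum.
Qed.

Section coupon_law.
Context (R : realType) (d : measure_display) (Om : measurableType d)
  (P : probability Om R) (V : finType).
Implicit Types (X : {RV P >-> {set V}}) (B : {set V}).

Definition coupon_law X B : R := fine (P (X @^-1` [set B])).

Lemma measurable_coupon X (A : set {set V}) : measurable (X @^-1` A).
Proof. exact: measurable_funPTI. Qed.

Lemma coupon_lawE X B : P (X @^-1` [set B]) = (coupon_law X B)%:E.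
Proof. by rewrite fineK ?fin_num_measure//; exact: measurable_coupon. Qed.

Lemma coupon_law_ge0 X B : 0 <= coupon_law X B.
Proof. exact: fine_ge0. Qed.

Lemma sum_coupon_law X : \sum_B coupon_law X B = 1.
Proof.
apply: EFin_inj; rewrite -sumEFin -(probability_setT P).
have <- : [set w | predT (X w)] = [set: Om] by apply/seteqP; split.
rewrite probability_finite_partition => [|B]; last exact: measurable_coupon.
by apply: eq_bigr => B _; rewrite coupon_lawE.
Qed.

(** The integrand is a finite nonnegative combination of indicators of the fibres of [X]. *)
Lemma expectation_coupon X (phi : {set V} -> R) : (forall B, 0 <= phi B) ->
  fine 'E_P[fun w => phi (X w)] = \sum_B coupon_law X B * phi B.
Proof.
move=> phi_ge0; rewrite unlock.
have E w : (phi (X w))%:E =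
    (\sum_B (phi B * \1_(X @^-1` [set B]) w)%:E)%E :> \bar R.
  rewrite sumEFin (bigD1 (X w))//= indicE mem_set// mulr1 big1 ?addr0// => B BX.
  by rewrite indicE memNset ?mulr0// => /= XB; rewrite XB eqxx in BX.
under eq_integral do rewrite E.
rewrite ge0_integral_sum//; last first.
- by move=> B w _; rewrite lee_fin mulr_ge0.
- move=> B; apply/measurable_EFinP/measurable_funM => //.
  by apply: measurable_indic; exact: measurable_coupon.
rewrite (eq_bigr (fun B => (coupon_law X B * phi B)%:E)); first by rewrite sumEFin.
move=> B _.
rewrite (integralZl_indic measurableT (fun=> X @^-1` [set B])); last 2 first.
- by move=> /lt_geF; rewrite phi_ge0.
- exact: measurable_coupon.
rewrite integral_indic//; last exact: measurable_coupon.
by rewrite /= setIT coupon_lawE EFinM muleC.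
Qed.

Lemma mean_sizeE X : mean_size X = \sum_B coupon_law X B * #|B|%:R.
Proof. by rewrite -expectation_coupon. Qed.

Lemma mean_square_sizeE X :
  mean_square_size X = \sum_B coupon_law X B * #|B|%:R ^+ 2.
Proof. by rewrite -expectation_coupon// => B; exact: sqr_ge0. Qed.

Lemma coupon_law_max_size X B : 0 < coupon_law X B -> (#|B| <= max_size X)%N.
Proof.
move=> B_gt0; have BV : (#|B| < #|V|.+1)%N by rewrite ltnS max_card.
rewrite /max_size (leq_bigmax_cond (Ordinal BV))//=.
apply: (@lt_le_trans _ _ (P (X @^-1` [set B]))); first by rewrite coupon_lawE lte_fin.
apply: le_measure; rewrite ?inE; first exact: measurable_coupon.
  exact: (measurable_coupon X [set B' : {set V} | #|B'| = #|B|]).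
by move=> w /= ->.
Qed.

Lemma coupon_law_exchangeable X (s : {perm V}) B :
  exchangeable X -> coupon_law X (s @: B)%SET = coupon_law X B.
Proof.
move=> /(_ s [set (s @: B)%SET]) XX.
rewrite /coupon_law -XX; congr (fine (P _)); apply/seteqP; split => w /=.
  by move/(imset_inj (@perm_inj _ s)).
by move->.
Qed.

End coupon_law.

(** * The collected set and the covering time *)

Section collector.
Context (R : realType) (d d' : measure_display) (Om : measurableType d)
  (Om' : measurableType d') (P : probability Om R) (P' : probability Om' R)
  (V : finType) (X : {RV P >-> {set V}}) (Xs : nat -> {RV P' >-> {set V}}).

Lemma iid_coupon_law i : iid_coupons X Xs -> coupon_law (Xs i) = coupon_law X.
Proof. by move=> [XX _]; apply/funext => B; rewrite /coupon_law; congr fine; exact: XX. Qed.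

Lemma probability_collected (t : nat) (A : pred {set V}) : iid_coupons X Xs ->
  P' [set w | A (collected Xs t w)] =
  (\sum_(f : {ffun 'I_t -> {set V}} | A (\bigcup_i f i)%SET)
     \prod_i coupon_law X (f i))%:E.
Proof.
move=> iid; pose Y w := [ffun i : 'I_t => Xs i w].
pose J := [fset i in iota 0 t]%fset.
(* Independence is stated for finite sets of natural numbers, so the fibre becomes an intersection
   over [J], each index carrying the constraint of the ordinal equal to it. *)
have YE f : Y @^-1` [set f] =
    \bigcap_(i in [set` J]) (Xs i @^-1` [set B | forall j : 'I_t, i = j -> B = f j]).
  apply/seteqP; split => [w /= <- i /=|w /= Jf].
    by move=> _ j ij; rewrite ffunE ij.
  by apply/ffunP => j; rewrite ffunE; apply: (Jf (val j)) => //=; rewrite inE mem_iota ltn_ord.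
have -> : [set w | A (collected Xs t w)] =
    [set w | [pred f : {ffun 'I_t -> {set V}} | A (\bigcup_i f i)%SET] (Y w)].
  have UY w : (\bigcup_i Y w i)%SET = collected Xs t w.
    by apply: eq_bigr => i _; rewrite ffunE.
  by apply/seteqP; split => w /=; rewrite UY.
rewrite probability_finite_partition => [|f]; last first.
  by rewrite YE; apply: fin_bigcap_measurable => // i _; exact: measurable_coupon.
rewrite -sumEFin; apply: eq_bigr => f _.
rewrite YE iid.2 -prodEFin.
rewrite (perm_big (iota 0 t)) /=; last first.
  by apply: uniq_perm; rewrite ?fset_uniq ?iota_uniq// => i; rewrite inE.
rewrite -{1}(subn0 t) -/(index_iota 0 t) big_mkord; apply: eq_bigr => i _.
rewrite -(iid_coupon_law i iid) -coupon_lawE; congr (P' _).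
apply/seteqP; split => w /=; first exact.
by move=> -> j /val_inj ->.
Qed.

Lemma measurable_collected (t : nat) (A : set {set V}) :
  measurable [set w | A (collected Xs t w)].
Proof.
pose Y w := [ffun i : 'I_t => Xs i w].
have -> : [set w | A (collected Xs t w)] =
    \bigcup_(f in [set f : {ffun 'I_t -> {set V}} | A (\bigcup_i f i)%SET])
       \bigcap_(i in [set: 'I_t]) (Xs i @^-1` [set f i]).
  have UY w : (\bigcup_i Y w i)%SET = collected Xs t w.
    by apply: eq_bigr => i _; rewrite ffunE.
  apply/seteqP; split => [w Aw|w [f /=]].
    exists (Y w); first by rewrite /= UY.
    by move=> i _; rewrite /= ffunE.
  by move=> Af fw; rewrite /collected (eq_bigr f)// => i _; exact: fw.
apply: fin_bigcup_measurable => // f _; apply: fin_bigcap_measurable => // i _.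
exact: measurable_coupon.
Qed.

Lemma subset_collected (s t : nat) w : (s <= t)%N ->
  (collected Xs s w \subset collected Xs t w)%SET.
Proof.
move=> st; apply/bigcupsP => i _.
by apply: (bigcup_max (widen_ord st i)).
Qed.

Lemma covering_time_gt (s : R) w : 0 <= s ->
  (s%:E < covering_time Xs w)%E -> collected Xs (Num.truncn s) w <> [set: V]%SET.
Proof.
move=> s0 sT cV; move: sT; apply/negP; rewrite -leNgt.
apply: (@le_trans _ _ (Num.truncn s)%:R%:E).
  by apply: ereal_inf_lbound; exists (Num.truncn s).
by rewrite lee_fin truncn_le.
Qed.

Lemma covering_time_lt (s : R) w :
  (covering_time Xs w < s%:E)%E -> collected Xs (Num.truncn s) w = [set: V]%SET.
Proof.
move=> /ereal_inf_lt[_ [t /= tV <-]]; rewrite lte_fin => ts.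
apply/eqP; rewrite finset.eqEsubset finset.subsetT -tV subset_collected//.
have s0 : 0 <= s by apply: le_trans (ltW ts); exact: ler0n.
by rewrite truncn_ge_nat// ltW.
Qed.

(** The time is a countable infimum of measurable functions: [u t] is [t] if [t] coupons cover, and
    [+oo] otherwise. *)
Lemma measurable_covering_time : measurable_fun setT (covering_time Xs).
Proof.
pose u t w : \bar R := if collected Xs t w == [set: V]%SET then t%:R%:E else +oo%E.
have -> : covering_time Xs = fun w => einfs (u^~ w) 0.
  apply/funext => w; apply/le_anti/andP; split.
    apply: le_ereal_inf_tmp => _ [t _ <-]; rewrite /u; case: ifPn => [/eqP tV|_]; last exact: leey.
    by apply: ereal_inf_lbound; exists t.
  apply: le_ereal_inf_tmp => _ [t /= tV <-]; apply: ereal_inf_lbound; exists t => //.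
  by rewrite /u tV eqxx.
apply: measurable_fun_einfs => t.
apply: measurable_fun_ifT => //.
apply: (@measurable_fun_bool _ _ _ _ true); rewrite setTI.
rewrite (_ : _ @^-1` _ = [set w | collected Xs t w = [set: V]%SET]).
  exact: (measurable_collected t [set [set: V]%SET]).
by apply/seteqP; split => w /= /eqP.
Qed.

(** A relative deviation above [eps] puts the time above [b] or below [a]. These are only compared
    with the scale [g], so they may be computed from another scale. *)
Lemma probability_deviation (g eps a b : R) : 0 < g -> 0 <= b ->
  (1 - eps) * g <= a -> b <= (1 + eps) * g ->
  (P' [set w | (eps%:E < `|covering_time Xs w * g^-1%:E - 1|)%E] <=
   P' [set w | collected Xs (Num.truncn b) w != [set: V]%SET] +
   P' [set w | collected Xs (Num.truncn a) w == [set: V]%SET])%E.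
Proof.
move=> g0 b0 ag bg.
apply: le_trans (measureU2 _ _ _); last 2 first.
- exact: (measurable_collected _ [set B | B != [set: V]%SET]).
- exact: (measurable_collected _ [set B | B == [set: V]%SET]).
apply: le_measure; rewrite ?inE.
- rewrite -[X in measurable X]setTI; apply: emeasurable_fun_o_infty => //.
  apply: measurableT_comp => //; apply: emeasurable_funB => //.
  by apply: emeasurable_funM => //; exact: measurable_covering_time.
- apply: measurableU.
    exact: (measurable_collected _ [set B | B != [set: V]%SET]).
  exact: (measurable_collected _ [set B | B == [set: V]%SET]).
move=> w /= dev.
suff [bT|Ta] : (b%:E < covering_time Xs w)%E \/ (covering_time Xs w < a%:E)%E.
- by left; apply/eqP; exact: covering_time_gt.
- by right; apply/eqP; exact: covering_time_lt.
(* The value [+oo] falls on the upper side and [-oo] on the lower; a finite value is sorted by the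
   sign of its deviation. *)
case: (covering_time Xs w) dev => [r| |] /=; last 2 first.
- by left; rewrite ltry.
- by right; rewrite ltNyr.
rewrite lte_fin => dev; rewrite !lte_fin.
have rE : r = (r / g - 1 + 1) * g by rewrite subrK divfK// gt_eqF.
have [r1|r1] := leP 0 (r / g - 1).
  left; move: dev; rewrite ger0_norm// => dev.
  by rewrite (le_lt_trans bg)// rE ltr_pM2r//; lra.
right; move: dev; rewrite ltr0_norm// => dev.
by rewrite (lt_le_trans _ ag)// rE ltr_pM2r//; lra.
Qed.

(** * Covering probabilities in terms of the coupon parameters *)

Section bounds.
Hypotheses (Xexch : exchangeable X) (iid : iid_coupons X Xs) (V_gt0 : (0 < #|V|)%N).
Let m_ge0 := coupon_law_ge0 X.
Let m_exch s B := @coupon_law_exchangeable R d Om P V X s B Xexch.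
Let m_sum1 := sum_coupon_law X.
Local Notation n := (#|V|%:R : R).
Local Notation mu := (mean_size X).

Lemma probability_not_covered (t : nat) :
  (P' [set w | collected Xs t w != [set: V]%SET] <= (n * (1 - mu / n) ^+ t)%:E)%E.
Proof.
rewrite (probability_collected t (fun B => B != [set: V]%SET) iid) lee_fin.
have := sum_not_covers m_ge0 m_exch t V_gt0.
by rewrite (sum_missed m_sum1) -mean_sizeE.
Qed.

Lemma probability_covered_max_size (t : nat) : (max_size X < #|V|)%N ->
  (P' [set w | collected Xs t w == [set: V]%SET] <=
   ((1 + mu / n / (1 - (max_size X)%:R / n)) ^+ t / n)%:E)%E.
Proof.
move=> Mn; rewrite (probability_collected t (fun B => B == [set: V]%SET) iid) lee_fin.
rewrite mean_sizeE; apply: sum_covers_bounded_size => // B.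
exact: coupon_law_max_size.
Qed.

Lemma probability_covered_variance (t : nat) : mu / n < 1 ->
  (P' [set w | collected Xs t w == [set: V]%SET] <=
   ((n * (1 - mu / n) ^+ t)^-1 +
    (1 + (mean_square_size X / n ^+ 2 - (mu / n) ^+ 2) / (1 - mu / n) ^+ 2) ^+ t
    - 1)%:E)%E.
Proof.
move=> mun; rewrite (probability_collected t (fun B => B == [set: V]%SET) iid) lee_fin.
move: mun; rewrite mean_sizeE mean_square_sizeE => mun.
exact: sum_covers_variance.
Qed.

Lemma mean_size_le_max_size : mu <= (max_size X)%:R.
Proof.
rewrite mean_sizeE -[leRHS]mul1r -[X in _ <= X * _]m_sum1 mulr_suml; apply: ler_sum => B _.
have := m_ge0 B; rewrite le_eqVlt => /predU1P[<-|mB]; first by rewrite !mul0r.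
by rewrite ler_pM2l// ler_nat coupon_law_max_size.
Qed.

End bounds.
End collector.

(** * Real inequalities at the times [(1 + delta) ln N / L] and [(1 - delta) ln N / L] *)

Section tail_estimates.
Context (R : realType) (N p delta : R).
Hypotheses (N_gt1 : 1 < N) (p_gt0 : 0 < p) (p_lt1 : p < 1).
Hypotheses (delta_gt0 : 0 < delta) (delta_lt1 : delta < 1).
Let L := - ln (1 - p).

Let N_gt0 : 0 < N. Proof. exact: lt_trans N_gt1. Qed.
Let lnN_gt0 : 0 < ln N. Proof. exact: ln_gt0. Qed.
Let p1_gt0 : 0 < 1 - p. Proof. by rewrite subr_gt0. Qed.

Lemma le_Nln1B : p <= L.
Proof. by rewrite lerNr le_ln1Dx// ltrN2. Qed.

Let L_gt0 : 0 < L. Proof. exact: lt_le_trans p_gt0 le_Nln1B. Qed.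

Let exprL t : (1 - p) ^+ t = expR (- (t%:R * L)).
Proof. by rewrite mulrN opprK expRM_natl lnK. Qed.

(** Truncating the time loses less than one coupon, that is, at most one factor [1 - p]; hence the
    denominator. *)
Lemma upper_tail_le :
  N * (1 - p) ^+ Num.truncn ((1 + delta) * (ln N / L)) <=
  expR (- (delta * ln N)) / (1 - p).
Proof.
set t := Num.truncn _.
have tL : (1 + delta) * ln N - L <= t%:R * L.
  rewrite lerBlDr -[X in _ <= _ + X]mul1r -mulrDl natr1 -ler_pdivrMr// -mulrA.
  by rewrite ltW// truncnS_gt.
rewrite exprL -[X in X * _]lnK ?posrE// -[in leRHS](lnK p1_gt0) -expRN -!expRD ler_expR.
by move: tL; rewrite -/L; lra.
Qed.

Let t := Num.truncn ((1 - delta) * (ln N / L)).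

Let t_le : t%:R * L <= (1 - delta) * ln N.
Proof.
rewrite -ler_pdivlMr// -mulrA truncn_le mulr_ge0 ?subr_ge0 ?(ltW delta_lt1)//.
by rewrite divr_ge0// ltW.
Qed.

Let tp_le : t%:R * p <= (1 - delta) * ln N.
Proof. by apply: le_trans t_le; rewrite ler_wpM2l// le_Nln1B. Qed.

(** Here [M] is the maximum size relative to [n]. Use [1 + x <= expR x] and
    [t p <= (1 - delta) ln N], then [1 - delta <= (1 - delta/2)^2 <= (1 - delta/2) (1 - M)]. *)
Lemma lower_tail_bounded_size_le M : M <= delta / 2 ->
  (1 + p / (1 - M)) ^+ t / N <= expR (- (delta / 2 * ln N)).
Proof.
move=> Md; have M1 : 0 < 1 - M by move: Md delta_lt1; lra.
rewrite ler_pdivrMr// -[X in _ <= _ * X](lnK N_gt0) -expRD.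
apply: (@le_trans _ _ (expR (p / (1 - M)) ^+ t)).
  by rewrite lerXn2r ?nnegrE ?expR_ge0 ?expR_ge1Dx// addr_ge0// divr_ge0// ltW.
rewrite -expRM_natl ler_expR mulrA ler_pdivrMr//; apply: le_trans tp_le _.
have -> : (- (delta / 2 * ln N) + ln N) * (1 - M) = (1 - delta / 2) * (1 - M) * ln N.
  by ring.
rewrite ler_pM2r//; apply: (@le_trans _ _ ((1 - delta / 2) * (1 - delta / 2))).
  by have := sqr_ge0 delta; nra.
by rewrite ler_pM2l; move: delta_lt1 Md; lra.
Qed.

(** The first term uses [t L <= (1 - delta) ln N], the second [1 + v <= expR |v|]; the absolute
    value makes the sign of [v] immaterial. *)
Lemma lower_tail_variance_le v :
  (N * (1 - p) ^+ t)^-1 + (1 + v) ^+ t - 1 <=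
  expR (- (delta * ln N)) + (expR (t%:R * `|v|) - 1).
Proof.
rewrite -addrA lerD//.
  rewrite exprL -[X in X * _]lnK ?posrE// -expRD -expRN ler_expR.
  by move: t_le; lra.
rewrite lerD2r (le_trans (ler_norm _))// normrX expRM_natl.
rewrite lerXn2r ?nnegrE ?expR_ge0// (le_trans _ (expR_ge1Dx _))//.
by rewrite (le_trans (ler_normD _ _))// normr1.
Qed.

Lemma lower_tail_length_le : t%:R * p <= ln N.
Proof. by apply: le_trans tp_le _; rewrite ler_piMl ?gerBl// ltW. Qed.

(** Since [L = ln (1 + p / (1 - p)) <= p / (1 - p)]. With [p <= L] this makes [L] and [p] equivalent
    as [p] tends to [0]. *)
Lemma Nln1B_le e : 0 < e -> p <= e / (1 + e) -> L <= (1 + e) * p.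
Proof.
move=> e0 pe; have pe' : p * (1 + e) <= e by rewrite -ler_pdivlMr// addr_gt0.
apply: (@le_trans _ _ (p / (1 - p))).
  have -> : L = ln (1 + p / (1 - p)).
    rewrite /L -lnV ?posrE//; congr ln; field; exact: lt0r_neq0.
  by rewrite le_ln1Dx// (lt_le_trans (ltrN10 _))// divr_ge0 ?ltW.
rewrite ler_pdivrMr// -subr_ge0.
have -> : (1 + e) * p * (1 - p) - p = p * (e - p * (1 + e)) by ring.
by rewrite mulr_ge0 ?subr_ge0// ltW.
Qed.

End tail_estimates.

(** * Limits as [n] tends to infinity *)

Lemma near_le_ln (R : realType) (K : R) : \forall n \near \oo, K <= ln n%:R.
Proof.
near=> n; have Kn : expR K <= n%:R by near: n; exact: nbhs_infty_ger.
by rewrite -(expRK K) ler_ln ?posrE ?expR_gt0// (lt_le_trans (expR_gt0 K)).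
Unshelve. all: by end_near. Qed.

Lemma near_expR_Nln_le (R : realType) (c eta : R) : 0 < c -> 0 < eta ->
  \forall n \near \oo, expR (- (c * ln n%:R)) <= eta.
Proof.
move=> c0 eta0; near=> n; rewrite -(lnK eta0) ler_expR lerNl -ler_pdivrMl//.
by near: n; exact: near_le_ln.
Unshelve. all: by end_near. Qed.

Lemma cvge0_near_le (R : realType) (u : nat -> \bar R) : (forall n, (0 <= u n)%E) ->
  (forall eta : R, 0 < eta -> \forall n \near \oo, (u n <= eta%:E)%E) ->
  u @ \oo --> 0%E.
Proof.
move=> u0 ueta.
have fin (x : \bar R) eta : (0 <= x)%E -> (x <= eta%:E)%E -> x \is a fin_num.
  by case: x.
apply/fine_cvgP; split.
  by near=> n; apply: (fin _ 1) => //; near: n; exact: ueta.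
apply/cvgrPdist_le => eta eta0; near=> n.
have un : (u n <= eta%:E)%E by near: n; exact: ueta.
by rewrite sub0r normrN /= ger0_norm ?fine_ge0// -lee_fin fineK// (fin _ eta).
Unshelve. all: by end_near. Qed.

(** * Concentration from the two tails *)

Section whp.
Context (R : realType) (d : nat -> measure_display)
  (Om : forall n, measurableType (d n)) (P : forall n, probability (Om n) R)
  (Xs : forall n, nat -> {RV (P n) >-> {set 'I_n}}).

(** Tails are bounded at the scale [f] and the conclusion is drawn at an equivalent scale [g], so
    one pair of tail bounds serves both forms of the asymptotics. *)
Lemma whp_of_tails (f g : nat -> R) :
  (\forall n \near \oo, 0 < f n) ->
  (forall e, 0 < e ->
     \forall n \near \oo, (1 - e) * f n <= g n /\ g n <= (1 + e) * f n) ->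
  (forall delta eta, 0 < delta -> delta < 1 -> 0 < eta -> \forall n \near \oo,
     (P n [set w | collected (Xs n) (Num.truncn ((1 + delta) * f n)) w != [set: 'I_n]%SET]
        <= eta%:E)%E) ->
  (forall delta eta, 0 < delta -> delta < 1 -> 0 < eta -> \forall n \near \oo,
     (P n [set w | collected (Xs n) (Num.truncn ((1 - delta) * f n)) w == [set: 'I_n]%SET]
        <= eta%:E)%E) ->
  whp_asymptotic P (fun n => covering_time (Xs n)) g.
Proof.
move=> f0 fg upper lower eps eps0.
apply: cvge0_near_le => [n|eta eta0]; first exact: measure_ge0.
(* Small enough that [1 + e <= (1 + eps) (1 - e)] and, when [eps < 1],
   [(1 - eps) (1 + e) <= 1 - e]. *)
pose e := Num.min eps 1 / 4.
have e0 : 0 < e by rewrite divr_gt0// lt_min eps0/=.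
have e1 : e <= 4^-1 by rewrite ler_pdivrMr// mulVf// ge_min lexx orbT.
have eeps : e <= eps / 4 by rewrite ler_pM2r// ge_min lexx.
have e_lt1 : e < 1 by lra.
have g0 (x y : R) : 0 < x -> (1 - e) * x <= y -> 0 < y.
  by move=> x0; apply: lt_le_trans; rewrite mulr_gt0// subr_gt0.
have eta2 : 0 < eta / 2 by rewrite divr_gt0.
near=> n.
have fn0 : 0 < f n by near: n.
have [gl gu] : (1 - e) * f n <= g n /\ g n <= (1 + e) * f n by near: n; exact: fg.
apply: le_trans.
  apply: (@probability_deviation _ _ _ (P n) _ (Xs n) (g n) eps ((1 - e) * f n) ((1 + e) * f n)).
  - exact: g0 gl.
  - by rewrite mulr_ge0 ?addr_ge0// ltW.
  - have [eps1|eps1] := leP 1 eps.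
      rewrite (@le_trans _ _ 0)//.
        by rewrite mulr_le0_ge0 ?subr_le0// ltW// (g0 _ _ fn0).
      by rewrite mulr_ge0 ?subr_ge0// ltW.
    apply: (@le_trans _ _ ((1 - eps) * ((1 + e) * f n))).
      by rewrite ler_wpM2l// subr_ge0 ltW.
    rewrite mulrA ler_pM2r//; nra.
  - apply: (@le_trans _ _ ((1 + eps) * ((1 - e) * f n))).
      rewrite mulrA ler_pM2r//; nra.
    by rewrite ler_wpM2l// addr_ge0// ltW.
rewrite [eta]splitr EFinD leeD//.
  by near: n; exact: upper.
by near: n; exact: lower.
Unshelve. all: by end_near. Qed.
End whp.

(** * Concentration of the covering time under the four conditions *)

Theorem theorem3p6 (R : realType)
  (d d' : nat -> measure_display)
  (Om : forall n, measurableType (d n)) (P : forall n, probability (Om n) R)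
  (X : forall n, {RV (P n) >-> {set 'I_n}})
  (Om' : forall n, measurableType (d' n)) (P' : forall n, probability (Om' n) R)
  (Xs : forall n, nat -> {RV (P' n) >-> {set 'I_n}}) :
  let M : nat -> R := fun n => (max_size (X n))%:R in
  let mu : nat -> R := fun n => mean_size (X n) in
  let chi : nat -> R := fun n => mean_square_size (X n) in
  (forall n, (0 < n)%N ->
    [/\ exchangeable (X n), 0 < mu n & iid_coupons (X n) (Xs n)]) ->
  [\/ M =o_\oo (fun n => Num.sqrt (n%:R * ln n%:R)),
      M =o_\oo (fun n => n%:R : R) /\
        M =o_\oo (fun n => Num.sqrt (mu n * n%:R * ln n%:R)),
      M =o_\oo (fun n => n%:R : R) /\
        chi =o_\oo (fun n => mu n * n%:R * ln n%:R)
    | (exists2 delta : R, 0 < delta &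
        forall n, (0 < n)%N -> mu n < (1 - delta) * n%:R) /\
      (exists2 h : nat -> R, h =o_\oo (fun n => (mu n * n%:R * ln n%:R)^-1) &
        forall n, (0 < n)%N -> chi n = (1 + h n) * mu n ^+ 2)] ->
  whp_asymptotic P' (fun n => covering_time (Xs n))
    (fun n => ln n%:R / - ln (1 - mu n / n%:R)) /\
  (mu =o_\oo (fun n => n%:R : R) ->
    whp_asymptotic P' (fun n => covering_time (Xs n))
      (fun n => n%:R * ln n%:R / mu n)).
Proof.
move=> M mu chi H cond.
pose p n : R := mu n / n%:R.
have p_gt0 n : (0 < n)%N -> 0 < p n by move=> n0; have [_ ? _] := H n n0; rewrite divr_gt0// ltr0n.
have p_le n : (0 < n)%N -> p n <= M n / n%:R.
  by move=> n0; rewrite ler_pM2r ?invr_gt0 ?ltr0n//; exact: mean_size_le_max_size.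
pose f n := ln n%:R / - ln (1 - p n).
have tail_of_bound n t (b : pred {set 'I_n}) (x eta : R) :
    (P' n [set w | b (collected (Xs n) t w)] <= x%:E)%E -> x <= eta ->
    (P' n [set w | b (collected (Xs n) t w)] <= eta%:E)%E.
  by move=> Px xeta; rewrite (le_trans Px)// lee_fin.
(* The part that depends on the case: the lower tail, and [p] bounded away from [1], from which the
   upper tail follows uniformly. *)
pose lower_tail := (exists2 d0, 0 < d0 & \forall n \near \oo, p n <= 1 - d0) /\
    (forall delta eta, 0 < delta -> delta < 1 -> 0 < eta -> \forall n \near \oo,
     (P' n [set w | collected (Xs n) (Num.truncn ((1 - delta) * f n)) w == [set: 'I_n]%SET]
        <= eta%:E)%E).
suff [[d0 d0_gt0 pd0] lower] : lower_tail.
  have f_gt0 : \forall n \near \oo, 0 < f n.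
    near=> n; have n1 : (1 < n)%N by near: n; exact: nbhs_infty_gt.
    have p0 : 0 < p n by rewrite p_gt0// ltnW.
    have pd : p n <= 1 - d0 by near: n.
    rewrite divr_gt0//; first by rewrite ln_gt0// ltr1n.
    by apply: lt_le_trans p0 _; apply: le_Nln1B; lra.
  have upper delta eta : 0 < delta -> delta < 1 -> 0 < eta -> \forall n \near \oo,
     (P' n [set w | collected (Xs n) (Num.truncn ((1 + delta) * f n)) w != [set: 'I_n]%SET]
        <= eta%:E)%E.
    move=> dl0 dl1 eta0; near=> n.
    have n1 : (1 < n)%N by near: n; exact: nbhs_infty_gt.
    have p0 : 0 < p n by rewrite p_gt0// ltnW.
    have pd : p n <= 1 - d0 by near: n.
    have p1 : p n < 1 by lra.
    have [Xexch _ iid] := H n (ltnW n1).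
    have := @probability_not_covered _ _ _ _ _ _ _ _ _ _ Xexch iid.
    rewrite card_ord => /(_ (ltnW n1) (Num.truncn ((1 + delta) * f n))) bnd.
    apply: (tail_of_bound _ _ (fun B => B != _) _ _ bnd).
    have n1R : 1 < n%:R :> R by rewrite ltr1n.
    apply: le_trans (@upper_tail_le _ _ _ delta n1R p0 p1) _.
    (* As [1 - p n >= d0], it is enough that [n^(- delta)] falls below [eta d0]. *)
    rewrite ler_pdivrMr ?subr_gt0//; apply: (@le_trans _ _ (eta * d0)).
      by near: n; apply: near_expR_Nln_le; rewrite ?mulr_gt0.
    by rewrite ler_pM2l//; lra.
  split.
    apply: (whp_of_tails f_gt0 _ upper lower) => e e0.
    near=> n; have fn : 0 < f n by near: n; exact: f_gt0.
    by split; rewrite mulrDl mul1r ?mulNr ?gerBl ?lerDl mulr_ge0// ltW.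
  (* The new scale is [ln n / p], which lies between [f] and [(1 + e) f] because
     [p <= L <= (1 + e) p] for small [p]. *)
  move=> /eqoP mu_o; apply: (whp_of_tails f_gt0 _ upper lower) => e e0.
  near=> n.
  have n1 : (1 < n)%N by near: n; exact: nbhs_infty_gt.
  have n0R : 0 < n%:R :> R by rewrite ltr0n ltnW.
  have p0 : 0 < p n by rewrite p_gt0// ltnW.
  have pd : p n <= 1 - d0 by near: n.
  have p1 : p n < 1 by lra.
  have ln0 : 0 < ln n%:R :> R by rewrite ln_gt0// ltr1n.
  have pL := le_Nln1B p1.
  have gE : n%:R * ln n%:R / mu n = ln n%:R / p n.
    by rewrite /p invf_div mulrA [ln _ * _]mulrC.
  have pe : p n <= e / (1 + e).
    rewrite ler_pdivrMr//; have : `|mu n| <= e / (1 + e) * `|n%:R|.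
      by near: n; apply: mu_o; rewrite divr_gt0// addr_gt0.
    by rewrite normr_nat; apply: le_trans; exact: ler_norm.
  have Lpe := Nln1B_le p0 p1 e0 pe.
  have L0 : 0 < - ln (1 - p n) by exact: lt_le_trans pL.
  rewrite gE; split.
    apply: (@le_trans _ _ (f n)).
      by rewrite -[leRHS]mul1r ler_wpM2r ?gerBl ?ltW// divr_gt0.
    by rewrite /f ler_wpM2l ?(ltW ln0)// lef_pV2.
  rewrite /f; set L := - ln _ in L0 Lpe *.
  have -> : (1 + e) * (ln n%:R / L) = ln n%:R * ((1 + e) / L) by rewrite mulrCA mulrA.
  rewrite ler_pM2l// -[leLHS]mul1r ler_pdivrMr// mulrAC.
  by rewrite ler_pdivlMr// mul1r.
have caseA : M =o_\oo (fun n => n%:R : R) -> lower_tail.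
  move=> /eqoP Mo.
  have Mle e : 0 < e -> \forall n \near \oo, M n / n%:R <= e.
    move=> e0; near=> n.
    have n0 : 0 < n%:R :> R by rewrite ltr0n; near: n; exact: nbhs_infty_gt.
    rewrite ler_pdivrMr//.
    have : `|M n| <= e * `|n%:R| by near: n; exact: Mo.
    by rewrite !normr_nat.
  split.
    (* Eventually [p <= M/n <= 1/2]. *)
    exists 2^-1 => //; near=> n.
    have n0 : (0 < n)%N by near: n; exact: nbhs_infty_gt.
    apply: le_trans (p_le _ n0) _; apply: (@le_trans _ _ 2^-1); last by lra.
    by near: n; exact: Mle.
  move=> delta eta dl0 dl1 eta0; near=> n.
  have n1 : (1 < n)%N by near: n; exact: nbhs_infty_gt.
  have n1R : 1 < n%:R :> R by rewrite ltr1n.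
  have n0R : 0 < n%:R :> R by rewrite ltr0n ltnW.
  have p0 : 0 < p n by rewrite p_gt0// ltnW.
  have Md : M n / n%:R <= delta / 2 by near: n; apply: Mle; rewrite divr_gt0.
  have M1 : M n / n%:R < 1 by lra.
  have p1 : p n < 1 by rewrite (le_lt_trans (p_le _ (ltnW n1))).
  have [Xexch _ iid] := H n (ltnW n1).
  have Mn : (max_size (X n) < n)%N.
    by move: M1; rewrite ltr_pdivrMr// mul1r ltr_nat.
  have := @probability_covered_max_size _ _ _ _ _ _ _ _ _ _ Xexch iid.
  rewrite card_ord => /(_ (Num.truncn ((1 - delta) * f n)) Mn) bnd.
  apply: (tail_of_bound _ _ (fun B => B == _) _ _ bnd).
  apply: le_trans (lower_tail_bounded_size_le n1R p0 p1 dl1 Md) _.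
  by near: n; apply: near_expR_Nln_le; rewrite ?divr_gt0.
case: cond => [/eqoP c|[c _]|[c _]|[[dl dl0 c1] [h c2 c3]]].
(* Case (i) gives [M = o(n)], because [ln n <= n - 1] makes [sqrt (n ln n)] at most [n]. *)
- apply: caseA; apply/eqoP => e e0; near=> n.
  have n0 : (0 < n)%N by near: n; exact: nbhs_infty_gt.
  have n0R : 0 < n%:R :> R by rewrite ltr0n.
  have : `|M n| <= e * `|Num.sqrt (n%:R * ln n%:R)| by near: n; exact: c.
  move=> /le_trans; apply; rewrite ler_wpM2l ?(ltW e0)// normr_nat ger0_norm ?sqrtr_ge0//.
  rewrite -[leRHS](ger0_norm (ltW n0R)) -sqrtr_sqr ler_wsqrtr// expr2 ler_wpM2l ?(ltW n0R)//.
  have := @le_ln1Dx R (n%:R - 1); rewrite [1 + _]addrC subrK => nln.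
  by apply: le_trans (nln _) _; [lra|rewrite gerBl].
- exact: caseA.
- exact: caseA.
have p_lt n : (0 < n)%N -> p n < 1 - dl.
  by move=> n0; rewrite ltr_pdivrMr ?ltr0n// c1.
split; first by exists dl => //; near=> n; rewrite ltW// p_lt//; near: n; exact: nbhs_infty_gt.
move=> delta eta dl_gt0 dl_lt1 eta0.
have eta1 : 1 < 1 + eta / 2 by rewrite ltrDl divr_gt0.
(* Chosen so that [t |v| <= e / dl^2] gives [expR (t |v|) - 1 <= eta / 2], where [1 - p > dl]. *)
pose e := dl ^+ 2 * ln (1 + eta / 2).
have e0 : 0 < e by rewrite mulr_gt0 ?exprn_gt0// ln_gt0.
near=> n.
have n1 : (1 < n)%N by near: n; exact: nbhs_infty_gt.
have n1R : 1 < n%:R :> R by rewrite ltr1n.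
have n0R : 0 < n%:R :> R by rewrite ltr0n ltnW.
have p0 : 0 < p n by rewrite p_gt0// ltnW.
have pdl : p n < 1 - dl by rewrite p_lt// ltnW.
have p1 : p n < 1 by lra.
have [Xexch mu0 iid] := H n (ltnW n1).
have := @probability_covered_variance _ _ _ _ _ _ _ _ _ _ Xexch iid.
rewrite card_ord => /(_ (ltnW n1) (Num.truncn ((1 - delta) * f n)) p1) bnd.
apply: (tail_of_bound _ _ (fun B => B == _) _ _ bnd).
apply: le_trans (lower_tail_variance_le n1R p0 p1 dl_lt1 _) _.
rewrite [eta]splitr lerD//; first by near: n; apply: near_expR_Nln_le; rewrite ?divr_gt0.
rewrite lerBlDl -[leRHS]lnK ?posrE ?(lt_trans _ eta1)// ler_expR.
set t := Num.truncn _.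
have tp : t%:R * p n <= ln n%:R by exact: lower_tail_length_le.
have ln0 : 0 < ln n%:R :> R by rewrite ln_gt0.
have hn : `|h n| <= e / (mu n * n%:R * ln n%:R).
  rewrite -[X in _ <= _ * X]gtr0_norm ?invr_gt0 ?mulr_gt0//.
  by near: n; move/eqoP: c2; apply.
rewrite -/(chi n) c3 ?(ltnW n1)//.
(* The hypothesis on [chi] makes the variance of the relative size equal to [h p^2]. *)
have -> : ((1 + h n) * mu n ^+ 2 / n%:R ^+ 2 - (mean_size (X n) / n%:R) ^+ 2) /
    (1 - mean_size (X n) / n%:R) ^+ 2 = h n * p n ^+ 2 / (1 - p n) ^+ 2.
  rewrite -/(mu n) -/(p n); congr (_ / _).
  by rewrite /p; field; exact: lt0r_neq0.
have -> : `|h n * p n ^+ 2 / (1 - p n) ^+ 2| = `|h n| * p n ^+ 2 / (1 - p n) ^+ 2.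
  by rewrite normf_div normrM !(ger0_norm (sqr_ge0 _)).
have p1_gt0 : 0 < 1 - p n by rewrite subr_gt0.
rewrite mulrA ler_pdivrMr ?exprn_gt0//; apply: (@le_trans _ _ e); last first.
  rewrite /e mulrC ler_wpM2l ?ln_ge0 ?(ltW eta1)// lerXn2r ?nnegrE ?(ltW dl0) ?(ltW p1_gt0)//.
  by move: pdl; lra.
(* One factor [p] goes with [t], as [t p <= ln n]; the other cancels [mu] in the bound on [h],
   leaving [e / n^2 <= e]. *)
have -> : t%:R * (`|h n| * p n ^+ 2) = t%:R * p n * (`|h n| * p n) by ring.
apply: (@le_trans _ _ (ln n%:R * (e / (mu n * n%:R * ln n%:R) * p n))).
  apply: ler_pM => //; last by rewrite ler_wpM2r// ltW.
  - by rewrite mulr_ge0// ltW.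
  - by rewrite mulr_ge0// ltW.
have -> : ln n%:R * (e / (mu n * n%:R * ln n%:R) * p n) = e / n%:R ^+ 2.
  by rewrite /p; field; rewrite !lt0r_neq0.
by rewrite ler_pdivrMr ?exprn_gt0// ler_peMr ?(ltW e0)// exprn_ege1// ltW.
Unshelve. all: by end_near.
Qed.
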